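(* Let $\mathbb{Q}$ and $\mathbb{R}$ be quasigroups. Every arrow of the category $\mathbf{P}^{\Delta\Sigma}$ (of $\Delta\Sigma$-algebras) from $K\mathbb{Q}$ to $K\mathbb{R}$ is of the form $f_1\times f_2\times f_3$ for some homotopy $(f_1,f_2,f_3)$ from $\mathbb{Q}$ to $\mathbb{R}$, where $K:\mathbf{Qtp}\to\mathbf{P}^{\Delta\Sigma}$ is the comparison functor.
   Context: A quasigroup is an algebra $\mathbb{Q}=(Q;\cdot,/,\backslash)$ with three binary operations satisfying $(x\cdot y)/y=x$, $x\backslash(x\cdot y)=y$, $(x/y)\cdot y=x$, $x\cdot(x\backslash y)=y$. Dual division operations are defined by $x/\!/y=y/x$ and $x\backslash\!\backslash y=y\backslash x$. A quasigroup is semisymmetric if it satisfies $x\cdot(y\cdot x)=y$ (equivalently $x/y=x\backslash y=y\cdot x$; so a semisymmetric quasigroup is determined by its multiplication). A homomorphism of quasigroups is a function $f$ with $f(x)\cdot f(y)=f(x\cdot y)$. A homotopy from $\mathbb{Q}$ to $\mathbb{R}$ is a triple $(f_1,f_2,f_3)$ of functions $f_i:Q\to R$ with $f_1(x)\cdot f_2(y)=f_3(x\cdot y)$ for all $x,y\in Q$. $\mathbf{Qtp}$ is the category whose objects are all small quasigroups and whose arrows are homotopies, with componentwise composition and identities. $\mathbf{P}$ is the category whose objects are all small semisymmetric quasigroups and whose arrows are quasigroup homomorphisms. The functor $\Sigma:\mathbf{P}\to\mathbf{Qtp}$ is the identity on objects and $\Sigma f=(f,f,f)$. The functor $\Delta:\mathbf{Qtp}\to\mathbf{P}$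 maps $\mathbb{Q}$ to the semisymmetric quasigroup with base set $Q^3$ and multiplication $$(x_1,x_2,x_3)\,\nabla_3\,(y_1,y_2,y_3)=(x_2/\!/y_3,\;x_3\backslash\!\backslash y_1,\;x_1\cdot y_2),$$ and maps a homotopy $(f_1,f_2,f_3)$ to $f_1\times f_2\times f_3$, the map $(x_1,x_2,x_3)\mapsto(f_1(x_1),f_2(x_2),f_3(x_3))$. The functor $\Sigma$ is left adjoint to $\Delta$, with unit $\eta_{\mathbb{P}}:\mathbb{P}\to\Delta\Sigma\mathbb{P}$, $\eta_{\mathbb{P}}(x)=(x,x,x)$, and counit $\varepsilon_{\mathbb{Q}}:\Sigma\Delta\mathbb{Q}\to\mathbb{Q}$, $\varepsilon_{\mathbb{Q}}=(\pi_1,\pi_2,\pi_3)$, where $\pi_i:Q^3\to Q$ is the $i$th projection. A $\Delta\Sigma$-algebra is a pair $(\mathbb{C},h)$ with $\mathbb{C}$ an object of $\mathbf{P}$ and $h:\Delta\Sigma\mathbb{C}\to\mathbb{C}$ an arrow of $\mathbf{P}$ such that $h\circ\Delta\Sigma h=h\circ\Delta\varepsilon_{\Sigma\mathbb{C}}$ and $h\circ\eta_{\mathbb{C}}=\mathrm{id}_{\mathbb{C}}$. A morphism $(\mathbb{C},h)\to(\mathbb{C}',h')$ is an arrow $f:\mathbb{C}\to\mathbb{C}'$ of $\mathbf{P}$ with $f\circ h=h'\circ\Delta\Sigma f$. These form the category $\mathbf{P}^{\Delta\Sigma}$. The comparison functor $K$ is given by $K\mathbb{Q}=(\Delta\mathbb{Q},\Delta\varepsilon_{\mathbb{Q}})=(\Delta\mathbb{Q},\pi_1\times\pi_2\times\pi_3)$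 on objects and $Kf=\Delta f$ on arrows. *)

(* Defs.v *)
From mathcomp Require Import ssreflect ssrfun ssrbool.

Set Implicit Arguments.
Unset Strict Implicit.
Unset Printing Implicit Defensive.

Declare Scope quasigroup_scope.
Delimit Scope quasigroup_scope with qg.
Local Open Scope quasigroup_scope.

(* As in universal algebra, the empty quasigroup is allowed. *)
Record quasigroup := Quasigroup {
  qg_sort :> Type;
  qg_mul : qg_sort -> qg_sort -> qg_sort;
  qg_rdiv : qg_sort -> qg_sort -> qg_sort;
  qg_ldiv : qg_sort -> qg_sort -> qg_sort;
  qg_mulK : forall x y, qg_rdiv (qg_mul x y) y = x;
  qg_mulKl : forall x y, qg_ldiv x (qg_mul x y) = y;
  qg_divK : forall x y, qg_mul (qg_rdiv x y) y = x;
  qg_divKl : forall x y, qg_mul x (qg_ldiv x y) = y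
}.

Notation "x * y" := (qg_mul x y) : quasigroup_scope.
Notation "x / y" := (qg_rdiv x y) : quasigroup_scope.
Notation "x \ y" := (qg_ldiv x y) (at level 40, left associativity)
  : quasigroup_scope.

Definition dual_rdiv (Q : quasigroup) (x y : Q) : Q := y / x.
Definition dual_ldiv (Q : quasigroup) (x y : Q) : Q := y \ x.

Record semisym_quasigroup := SemisymQuasigroup {
  ss_qg :> quasigroup;
  ss_semisym : forall x y : ss_qg, x * (y * x) = y
}.

Section SemisymBuild.
Variables (T : Type) (mul : T -> T -> T).
Hypothesis mulP : forall x y, mul x (mul y x) = y.

Lemma semisym_mulV x y : mul (mul y x) y = x.
Proof. by rewrite -{2}(mulP x y) mulP. Qed.

(* The divisions of a semisymmetric quasigroup are x / y = x \ y = y * x. *)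
Definition qg_of_semisym : quasigroup :=
  @Quasigroup T mul (fun x y => mul y x) (fun x y => mul y x)
    (fun x y => mulP y x) (fun x y => semisym_mulV y x)
    (fun x y => semisym_mulV x y) (fun x y => mulP x y).

Definition semisym_build : semisym_quasigroup :=
  @SemisymQuasigroup qg_of_semisym mulP.
End SemisymBuild.

(* Arrows are compared by pointwise equality of the underlying functions. *)
Record qg_hom (P S : quasigroup) := QgHom {
  hom_fun :> P -> S;
  homM : forall x y, hom_fun x * hom_fun y = hom_fun (x * y)
}.

Record homotopy (Q R : quasigroup) := Homotopy {
  htp1 : Q -> R;
  htp2 : Q -> R;
  htp3 : Q -> R;
  htpM : forall x y, htp1 x * htp2 y = htp3 (x * y)
}.

Definition hom_id (P : quasigroup) : qg_hom P P :=
  @QgHom P P id (fun x y => erefl).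

Lemma hom_comp_subproof (P S T : quasigroup) (g : qg_hom S T) (f : qg_hom P S)
  (x y : P) : (g \o f) x * (g \o f) y = (g \o f) (x * y).
Proof. by rewrite /= !homM. Qed.

Definition hom_comp (P S T : quasigroup) (g : qg_hom S T) (f : qg_hom P S) :
  qg_hom P T := QgHom (hom_comp_subproof g f).

Definition htp_id (Q : quasigroup) : homotopy Q Q :=
  @Homotopy Q Q id id id (fun x y => erefl).

Lemma htp_comp_subproof (Q R S : quasigroup) (g : homotopy R S)
  (f : homotopy Q R) (x y : Q) :
  (htp1 g \o htp1 f) x * (htp2 g \o htp2 f) y = (htp3 g \o htp3 f) (x * y).
Proof. by rewrite /= !htpM. Qed.

Definition htp_comp (Q R S : quasigroup) (g : homotopy R S)
  (f : homotopy Q R) : homotopy Q S := Homotopy (htp_comp_subproof g f).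

Definition Sigma (P : semisym_quasigroup) : quasigroup := P.

Definition Sigma_map (P S : semisym_quasigroup) (f : qg_hom P S) :
  homotopy (Sigma P) (Sigma S) :=
  @Homotopy (Sigma P) (Sigma S) f f f (homM f).

Definition pi1 {T : Type} (x : T * T * T) : T := x.1.1.
Definition pi2 {T : Type} (x : T * T * T) : T := x.1.2.
Definition pi3 {T : Type} (x : T * T * T) : T := x.2.

Definition prod3 (T U : Type) (f1 f2 f3 : T -> U) (x : T * T * T) : U * U * U :=
  (f1 (pi1 x), f2 (pi2 x), f3 (pi3 x)).

Definition nabla3 (Q : quasigroup) (x y : Q * Q * Q) : Q * Q * Q :=
  (dual_rdiv (pi2 x) (pi3 y), dual_ldiv (pi3 x) (pi1 y), pi1 x * pi2 y).

Lemma nabla3_semisym (Q : quasigroup) (x y : Q * Q * Q) :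
  nabla3 x (nabla3 y x) = y.
Proof.
case: x y => [[x1 x2] x3] [[y1 y2] y3]; rewrite /nabla3 /dual_rdiv /dual_ldiv /pi1 /pi2 /pi3 /=.
by rewrite qg_mulK qg_divKl -{2}(qg_divK x3 y2) qg_mulKl.
Qed.

Definition Delta (Q : quasigroup) : semisym_quasigroup :=
  semisym_build (@nabla3_semisym Q).

Lemma Delta_map_subproof (Q R : quasigroup) (f : homotopy Q R)
  (x y : Delta Q) :
  (prod3 (htp1 f) (htp2 f) (htp3 f) x : Delta R)
    * (prod3 (htp1 f) (htp2 f) (htp3 f) y : Delta R)
  = prod3 (htp1 f) (htp2 f) (htp3 f) (x * y).
Proof.
case: x y => [[x1 x2] x3] [[y1 y2] y3].
rewrite /= /nabla3 /dual_rdiv /dual_ldiv /prod3 /pi1 /pi2 /pi3 /= htpM.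
rewrite -{1}(qg_divK y3 x2) -htpM qg_mulK.
by rewrite -{1}(qg_divKl y1 x3) -htpM qg_mulKl.
Qed.

Definition Delta_map (Q R : quasigroup) (f : homotopy Q R) :
  qg_hom (Delta Q) (Delta R) := QgHom (Delta_map_subproof f).

Definition diag3 (T : Type) (x : T) : T * T * T := (x, x, x).

Lemma eta_subproof (P : semisym_quasigroup) (x y : P) :
  (diag3 x : Delta (Sigma P)) * (diag3 y : Delta (Sigma P)) = diag3 (x * y).
Proof.
rewrite /= /nabla3 /dual_rdiv /dual_ldiv /diag3 /pi1 /pi2 /pi3 /=.
have xyx : (x * y) * x = y by apply: semisym_mulV (@ss_semisym P) _ _.
have yx : y / x = x * y by rewrite -[in LHS]xyx qg_mulK.
have yx' : y \ x = x * y by rewrite -[in LHS](ss_semisym y x) qg_mulKl.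
by rewrite yx yx'.
Qed.

Definition eta (P : semisym_quasigroup) : qg_hom P (Delta (Sigma P)) :=
  QgHom (@eta_subproof P).

Definition epsilon (Q : quasigroup) : homotopy (Sigma (Delta Q)) Q :=
  @Homotopy (Sigma (Delta Q)) Q pi1 pi2 pi3 (fun x y => erefl).

Record DS_alg := DSAlg {
  alg_obj : semisym_quasigroup;
  alg_str : qg_hom (Delta (Sigma alg_obj)) alg_obj;
  alg_strA : hom_comp alg_str (Delta_map (Sigma_map alg_str))
             =1 hom_comp alg_str (Delta_map (epsilon (Sigma alg_obj)));
  alg_str_eta : hom_comp alg_str (eta alg_obj) =1 hom_id alg_obj
}.

Record DS_alg_hom (A B : DS_alg) := DSAlgHom {
  alg_hom :> qg_hom (alg_obj A) (alg_obj B);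
  alg_homP : hom_comp alg_hom (alg_str A)
             =1 hom_comp (alg_str B) (Delta_map (Sigma_map alg_hom))
}.

Definition alg_hom_id (A : DS_alg) : DS_alg_hom A A.
Proof.
by exists (hom_id (alg_obj A)) => -[[x1 x2] x3].
Defined.

Definition alg_hom_comp (A B C : DS_alg) (g : DS_alg_hom B C)
  (f : DS_alg_hom A B) : DS_alg_hom A C.
Proof.
exists (hom_comp g f) => x.
by rewrite /= (alg_homP f x : f _ = _) (alg_homP g _ : g _ = _).
Defined.

Lemma K_strA (Q : quasigroup) :
  hom_comp (Delta_map (epsilon Q)) (Delta_map (Sigma_map (Delta_map (epsilon Q))))
  =1 hom_comp (Delta_map (epsilon Q)) (Delta_map (epsilon (Sigma (Delta Q)))).
Proof. by []. Qed.

Lemma K_str_eta (Q : quasigroup) :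
  hom_comp (Delta_map (epsilon Q)) (eta (Delta Q)) =1 hom_id (Delta Q).
Proof. by case=> [[]]. Qed.

Definition K (Q : quasigroup) : DS_alg :=
  @DSAlg (Delta Q) (Delta_map (epsilon Q)) (@K_strA Q) (@K_str_eta Q).

Lemma K_map_subproof (Q R : quasigroup) (f : homotopy Q R) :
  hom_comp (Delta_map f) (alg_str (K Q))
  =1 hom_comp (alg_str (K R)) (Delta_map (Sigma_map (Delta_map f))).
Proof. by []. Qed.

Definition K_map (Q R : quasigroup) (f : homotopy Q R) :
  DS_alg_hom (K Q) (K R) := @DSAlgHom (K Q) (K R) (Delta_map f) (K_map_subproof f).

Lemma K_map_id (Q : quasigroup) : K_map (htp_id Q) =1 alg_hom_id (K Q).
Proof. by case=> [[]]. Qed.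

Lemma K_map_comp (Q R S : quasigroup) (g : homotopy R S) (f : homotopy Q R) :
  K_map (htp_comp g f) =1 alg_hom_comp (K_map g) (K_map f).
Proof. by []. Qed.

(* Main.v *)
(* Put [f_i a := pi_i (g (a, a, a))]. Since [(x1, x2, x3)] is the image of the
   triple of diagonal elements [((x1, x1, x1), (x2, x2, x2), (x3, x3, x3))]
   under the structure map [pi1 x pi2 x pi3] of [K Q], compatibility of [g]
   with the structure maps gives [g = f1 x f2 x f3]. The third component of
   the homomorphism equation for [g] is then the homotopy equation. *)
Require Import Defs.
From mathcomp Require Import ssreflect ssrfun ssrbool.

Theorem lemma6p1 (Q R : quasigroup) (g : DS_alg_hom (K Q) (K R)) :
  exists f : homotopy Q R, g =1 prod3 (htp1 f) (htp2 f) (htp3 f).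
Proof.
pose f1 a := pi1 (g (diag3 a) : R * R * R).
pose f2 a := pi2 (g (diag3 a) : R * R * R).
pose f3 a := pi3 (g (diag3 a) : R * R * R).
have gE x : g x = prod3 f1 f2 f3 x.
  (* Both structure maps compute on explicit triples, so this instance of [alg_homP] is the goal up
     to conversion. *)
  by case: x => [[x1 x2] x3]; exact: (alg_homP g (diag3 x1, diag3 x2, diag3 x3)).
have fM x y : qg_mul (f1 x) (f2 y) = f3 (qg_mul x y).
  have /(congr1 pi3) := homM g (diag3 x) (diag3 y).
  (* The product of two diagonal triples is in general not diagonal, so [gE] is needed to read its
     third component as [f3 (x * y)]. The left side is already [f1 x * f2 y], by the third component
     of [nabla3]. *)
  by rewrite [in RHS]gE.
by exists (Homotopy fM).
Qed.
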